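(* Let $(X,\|\cdot\|_X)$ and $(E,\|\cdot\|_E)$ be finite-dimensional Banach spaces, let $(Y,\Sigma,\mu)$ be a measure space, and let $K:X\times Y\to B(E)$ satisfy: (Car1) $K(x,\cdot)$ is measurable for every $x\in X$; (Car2) $K(\cdot,y)$ is continuous for a.e. $y\in Y$; (Car3) for every $x\in X$ there exist an open neighbourhood $U_x$ of $x$ and a function $D_x\in L^1(Y)$ such that for every $z\in U_x$ and a.e. $y\in Y$ we have $\|K(z,y)\|\le D_x(y)$; (Car4) $\sup_{x\in X}\int_Y\|K(x,y)\|\,d\mu(y)<\infty$; (K1) for every $\varepsilon>0$ there exist, for each $v\in X$ with $\|v\|=1$, a number $T_v>0$ and a function $L_v\in L^1(Y,B(E))$ such that for every $t\ge T_v$ $$\int_Y\|K(tv,y)-L_v(y)\|\,d\mu(y)\le\varepsilon,$$ and moreover $\sup_{\|v\|=1}T_v<\infty$. Then the Fredholm operator $\mathscr{F}:L^\infty(Y,E)\to BC(X,E)$ defined by $$(\mathscr{F}f)(x):=\int_Y K(x,y)f(y)\,d\mu(y)$$ is (well defined,) linear and compact.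
   Context: $B(E)$ denotes the space of bounded linear operators on $E$ with the operator norm. $L^1(Y)$ and $L^1(Y,B(E))$ are the spaces of $\mu$-integrable scalar-valued, respectively $B(E)$-valued, functions on $Y$; $L^\infty(Y,E)$ is the space of essentially bounded measurable functions $Y\to E$ with the essential supremum norm. $BC(X,E)$ is the space of bounded continuous functions $X\to E$ with the norm $\|f\|=\sup_{x\in X}\|f(x)\|_E$. *)

(* Defs.v *)
From HB Require Import structures.
From mathcomp Require Import all_boot all_order all_algebra.
From mathcomp Require Import generic_quotient ring_quotient.
From mathcomp Require Import all_classical all_reals all_analysis.
From mathcomp Require Import ess_sup_inf ring lra.
Set Implicit Arguments.
Unset Strict Implicit.
Unset Printing Implicit Defensive.

Import Order.TTheory GRing.Theory Num.Theory.
Import numFieldNormedType.Exports.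
Local Open Scope classical_set_scope.
Local Open Scope ring_scope.

(* Finite-dimensional real Banach spaces, with an arbitrary norm. *)
#[short(type="finBanachType")]
HB.structure Definition FinBanach (R : realType) :=
  {V of CompleteNormedModule R V & Vector R V}.

Section supremum_norm.
Context {R : realType} {T : Type} {W : normedModType R}.
Implicit Types (D : set T) (f g : T -> W).

(* sup is 0 on unbounded sets of reals; sup_norm is only applied to functions
   that are bounded on D. *)
Definition sup_norm D f : R := sup [set `|f x| | x in D].

Definition bounded_on D f := exists M : R, forall x, D x -> `|f x| <= M.

Lemma sup_norm_ub D f x : bounded_on D f -> D x -> `|f x| <= sup_norm D f.
Proof.
move=> [M fM] Dx; apply: ub_le_sup; last by exists x.
by exists M => _ [y Dy <-]; exact: fM.
Qed.

Lemma sup_norm_le D f (M : R) : D !=set0 ->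
  (forall x, D x -> `|f x| <= M) -> sup_norm D f <= M.
Proof.
move=> [x Dx] fM; apply: ge_sup; first by exists `|f x|, x.
by move=> _ [y Dy <-]; exact: fM.
Qed.

Lemma sup_norm_ge0 D f : 0 <= sup_norm D f.
Proof.
have [hs|/sup_out h] := pselect (has_sup [set `|f x| | x in D]); last first.
  by rewrite /sup_norm h.
have [[_ [x Dx _]] ub] := hs.
by apply: (le_trans (normr_ge0 (f x))); apply: ub_le_sup => //; exists x.
Qed.

Lemma sup_normD D f g : D !=set0 -> bounded_on D f -> bounded_on D g ->
  sup_norm D (f + g) <= sup_norm D f + sup_norm D g.
Proof.
move=> D0 bf bg; apply: sup_norm_le => // x Dx.
by rewrite (le_trans (ler_normD _ _))// lerD// sup_norm_ub.
Qed.

Lemma sup_normZ D (a : R) f : D !=set0 -> bounded_on D f ->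
  sup_norm D (a *: f) = `|a| * sup_norm D f.
Proof.
have le b g : D !=set0 -> bounded_on D g ->
    sup_norm D (b *: g) <= `|b| * sup_norm D g.
  move=> D0 bg; apply: sup_norm_le => // x Dx.
  by rewrite normrZ ler_wpM2l// sup_norm_ub.
move=> D0 bf; apply/eqP; rewrite eq_le le//=.
have [->|a0] := eqVneq a 0; first by rewrite normr0 mul0r sup_norm_ge0.
rewrite -ler_pdivlMl ?normr_gt0// -normfV.
rewrite -{1}[f](scalerK a0) le//.
case: bf => M fM; exists (`|a| * M) => x Dx.
by rewrite normrZ ler_wpM2l// fM.
Qed.

End supremum_norm.

Section bounded_operators.
Context {R : realType} (V W : normedModType R).

Definition bounded_linear : {pred V -> W} := fun f =>
  `[< linear f /\ exists M : R, forall x, `|f x| <= M * `|x| >].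

(* The space B(V, W), normed below by the operator norm. *)
Record bop := Bop { bop_fun :> V -> W ; bopP : bop_fun \in bounded_linear }.

HB.instance Definition _ := [isSub for bop_fun].
HB.instance Definition _ := [Choice of bop by <:].

Lemma bounded_linear_submod : submod_closed bounded_linear.
Proof.
split.
  apply/asboolP; split; first by move=> a u v /=; rewrite scaler0 addr0.
  by exists 0 => x; rewrite normr0 mul0r.
move=> a f g /asboolP[lf [M fM]] /asboolP[lg [N gN]]; apply/asboolP; split.
  move=> b u v; rewrite !fctE /= lf lg !scalerDr !scalerA (mulrC a b).
  by rewrite -!addrA; congr (_ + _); rewrite addrCA.
exists (`|a| * M + N) => x; rewrite (le_trans (ler_normD _ _))// mulrDl lerD//.
by rewrite normrZ -mulrA ler_wpM2l.
Qed.

HB.instance Definition _ :=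
  GRing.isSubmodClosed.Build _ _ bounded_linear bounded_linear_submod.
HB.instance Definition _ := [SubChoice_isSubLmodule of bop by <:].

Let unit_ball := [set x : V | `|x| <= 1].

Let unit_ball0 : unit_ball !=set0.
Proof. by exists 0; rewrite /unit_ball/= normr0 ler01. Qed.

Let bop_bounded (f : bop) : bounded_on unit_ball f.
Proof.
case: f => f /= /asboolP[_ [M fM]]; exists `|M| => x x1.
rewrite (le_trans (fM x))// (le_trans (ler_norm _))// normrM normr_id.
by rewrite ler_piMr.
Qed.

Definition op_norm (f : bop) : R := sup_norm [set x : V | `|x| <= 1] f.

Let op_normD (f g : bop) : op_norm (f + g) <= op_norm f + op_norm g.
Proof. exact: sup_normD. Qed.

Let op_normZ (a : R) (f : bop) : op_norm (a *: f) = `|a| * op_norm f.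
Proof. exact: sup_normZ. Qed.

Let op_norm_eq0 (f : bop) : op_norm f = 0 -> f = 0.
Proof.
move=> f0; apply/val_inj/funext => x /=.
have [lf _] := asboolP _ (bopP f).
have fZ a u : f (a *: u) = a *: f u.
  have f00 : f 0 = 0.
    by have := lf (-1) 0 0; rewrite scaler0 addr0 scaleN1r addNr.
  by have := lf a u 0; rewrite !addr0 f00 addr0.
have [->|x0] := eqVneq x 0; first by rewrite -(scale0r 0) fZ scale0r.
apply/eqP; rewrite -normr_le0.
have : `|f (`|x|^-1 *: x)| <= 0.
  rewrite -f0; apply: sup_norm_ub => //=.
  by rewrite normrZ normfV normr_id mulVf ?normr_eq0.
by rewrite fZ normrZ pmulr_rle0// normr_gt0 invr_neq0// normr_eq0.
Qed.

HB.instance Definition _ :=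
  Lmodule_isNormed.Build R bop op_normD op_normZ op_norm_eq0.

End bounded_operators.

Section bounded_continuous.
Context {R : realType} (X : ptopologicalType) (W : normedModType R).

Definition bounded_continuous : {pred X -> W} := fun f =>
  `[< continuous f /\ bounded_on setT f >].

Record BC := BCfun
  { bc_fun :> X -> W ; bcP : bc_fun \in bounded_continuous }.

HB.instance Definition _ := [isSub for bc_fun].
HB.instance Definition _ := [Choice of BC by <:].

Lemma bounded_continuous_submod : submod_closed bounded_continuous.
Proof.
split.
  apply/asboolP; split; first exact: cst_continuous.
  by exists 0 => x _; rewrite normr0.
move=> a f g /asboolP[cf [M fM]] /asboolP[cg [N gN]]; apply/asboolP; split.
  by move=> x; apply: cvgD; [apply: cvgZr; exact: cf|exact: cg].
exists (`|a| * M + N) => x _.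
rewrite (le_trans (ler_normD _ _))// lerD ?gN//.
by rewrite normrZ ler_wpM2l// fM.
Qed.

HB.instance Definition _ :=
  GRing.isSubmodClosed.Build _ _ bounded_continuous bounded_continuous_submod.
HB.instance Definition _ := [SubChoice_isSubLmodule of BC by <:].

Definition bc_norm (f : BC) : R := sup_norm setT f.

Let T0 : [set: X] !=set0. Proof. by exists point. Qed.

Let bc_bounded (f : BC) : bounded_on setT f.
Proof. by case: f => f /= /asboolP[]. Qed.

Let bc_normD (f g : BC) : bc_norm (f + g) <= bc_norm f + bc_norm g.
Proof. exact: sup_normD. Qed.

Let bc_normZ (a : R) (f : BC) : bc_norm (a *: f) = `|a| * bc_norm f.
Proof. exact: sup_normZ. Qed.

Let bc_norm_eq0 (f : BC) : bc_norm f = 0 -> f = 0.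
Proof.
move=> f0; apply/val_inj/funext => x /=.
by apply/eqP; rewrite -normr_le0 -f0; exact: sup_norm_ub.
Qed.

HB.instance Definition _ :=
  Lmodule_isNormed.Build R BC bc_normD bc_normZ bc_norm_eq0.

End bounded_continuous.

Section vector_valued_functions.
Context {R : realType} {d : measure_display} {Y : measurableType d}.
Variable mu : {measure set Y -> \bar R}.
Local Open Scope ereal_scope.

Section normed_target.
Context {V : normedModType R}.
Implicit Types (f g s : Y -> V) (v : V).

Definition borel_measurable f :=
  measurable_fun [set: Y] (f : Y -> g_sigma_algebraType (@open V)).

Definition ae_bounded f := ess_sup mu (fun y => `|f y|%:E) < +oo.

(* No separability of the range is required, so this is the right notion of
   integrability only for separable (here: finite-dimensional) V. *)
Definition L1_fun f :=
  borel_measurable f /\ \int[mu]_y `|f y|%:E < +oo.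

Definition simple_fun s :=
  [/\ finite_set (range s),
      forall v, measurable (s @^-1` [set v]) &
      forall v, v != 0%R -> mu (s @^-1` [set v]) < +oo].

(* The fibre over 0 may have infinite measure; its term is 0 anyway. *)
Definition simple_integral s : V :=
  (\sum_(v \in range s) fine (mu (s @^-1` [set v])) *: v)%R.

(* v is a limit of integrals of simple functions converging to f in mean. *)
Definition is_bochner_integral f v :=
  exists s : (Y -> V)^nat,
    [/\ forall n, simple_fun (s n),
        \int[mu]_y `|f y - s n y|%:E @[n --> \oo] --> 0 &
        simple_integral (s n) @[n --> \oo] --> v].

Definition bochner_integral f : V := xget 0%R [set v | is_bochner_integral f v].

End normed_target.
End vector_valued_functions.

Section finite_dimensional_measurability.
Context {R : realType} {d : measure_display} {Y : measurableType d}.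
Context {V : finBanachType R}.
Implicit Types f g : Y -> V.

Lemma borel_preimage (W : normedModType R) (f : Y -> W) :
  borel_measurable f <-> forall U : set W, open U -> measurable (f @^-1` U).
Proof.
split=> [mf U oU|mf].
  rewrite -[X in measurable X]setTI; apply: mf => //.
  exact: sub_sigma_algebra.
apply: (@measurability _ _ _ (g_sigma_algebraType (@open W)) _ _ (@open W)).
  by [].
by move=> _ [U oU <-]; rewrite setTI; exact: mf.
Qed.

Let n := \dim (fullv : {vspace V}).

Let b (i : 'I_n) : V := (vbasis fullv)`_i.

Let c (x : V) (i : 'I_n) : R := coord (vbasis fullv) i x.

Let rat_point (q : {ffun 'I_n -> rat}) : V := \sum_(i < n) ratr (q i) *: b i.

Let rat_point_dense (x : V) (e : R) : 0 < e ->
  exists q, `|x - rat_point q| < e.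
Proof.
move=> e0.
pose M := 1 + \sum_(i < n) `|b i|.
have M0 : 0 < M by rewrite ltr_pwDl// sumr_ge0.
have /(_ _)/cid-/all_sig[q qP] : forall i : 'I_n,
    exists q : rat, `|c x i - ratr q| < e / M.
  move=> i.
  have [|q] := @rat_in_itvoo R (c x i - e / M) (c x i + e / M).
    by rewrite ltrBlDr -addrA ltrDl addr_gt0// divr_gt0.
  rewrite in_itv/= => /andP[q1 q2]; exists q.
  by rewrite ltr_norml ltrBrDr addrC -ltrBrDr opprK q2/= ltrBlDl -ltrBlDr.
exists [ffun i => q i]; rewrite /rat_point.
have -> : x = \sum_(i < n) c x i *: b i.
  exact: (coord_vbasis (memvf x)).
rewrite -sumrB.
under eq_bigr do rewrite ffunE -scalerBl.
rewrite (le_lt_trans (ler_norm_sum _ _ _))//.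
apply: (@le_lt_trans _ _ (\sum_(i < n) e / M * `|b i|)).
  by apply: ler_sum => i _; rewrite normrZ ler_wpM2r// ltW.
by rewrite -mulr_sumr mulrAC ltr_pdivrMr// ltr_pM2l// ltrDr.
Qed.

Lemma borel_measurableD f g :
  borel_measurable f -> borel_measurable g -> borel_measurable (f + g)%R.
Proof.
move=> /borel_preimage mf /borel_preimage mg; apply/borel_preimage => U oU.
pose ok (t : {ffun 'I_n -> rat} * {ffun 'I_n -> rat} * nat) :=
  forall u v, ball (rat_point t.1.1) t.2.+1%:R^-1 u ->
    ball (rat_point t.1.2) t.2.+1%:R^-1 v -> U (u + v).
pose A (k : nat) : set Y := if unpickle k is Some t then
  if `[< ok t >] then
    f @^-1` ball (rat_point t.1.1) t.2.+1%:R^-1 `&`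
    g @^-1` ball (rat_point t.1.2) t.2.+1%:R^-1
  else set0 else set0.
have -> : (f + g) @^-1` U = \bigcup_k A k.
  apply/seteqP; split=> [y Uy|y [k _]]; last first.
    rewrite /A; case: unpickle => // t; case: ifPn => // /asboolP okt [fy gy].
    exact: okt.
  have /nbhs_ballP[e /= e0 eU] : nbhs (f y + g y) U by exact: open_nbhs_nbhs.
  have [k ke] : exists k, k.+1%:R^-1 < e / 4.
    pose e4 := PosNum (divr_gt0 e0 (ltr0n _ 4)).
    have [k _ /(_ _ (leqnn _))] := @near_infty_natSinv_lt R e4.
    by exists k.
  have k0 : 0 < k.+1%:R^-1 :> R by rewrite invr_gt0.
  have [p fp] := rat_point_dense (f y) k0.
  have [q gq] := rat_point_dense (g y) k0.
  exists (pickle ((p, q), k)) => //; rewrite /A pickleK; case: ifPn => [_|].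
    by split; rewrite /= -ball_normE/= distrC.
  case/asboolP => u v /=.
  rewrite -!ball_normE/= => pu qv; apply: eU.
  rewrite -ball_normE/=.
  have -> : f y + g y - (u + v) = (f y - rat_point p) + (rat_point p - u) +
      ((g y - rat_point q) + (rat_point q - v)).
    rewrite !addrA !subrK opprD addrACA -!addrA.
    by congr (_ + _); rewrite addrCA.
  have -> : e = e / 4 + e / 4 + (e / 4 + e / 4) by field.
  have h r x w z : `|x - r| < k.+1%:R^-1 -> `|r - w| < k.+1%:R^-1 ->
      z = (x - r) + (r - w) -> `|z : V| < e / 4 + e / 4.
    move=> xr ry ->; rewrite (le_lt_trans (ler_normD _ _))//.
    by rewrite ltrD// (lt_trans _ ke).
  rewrite (le_lt_trans (ler_normD _ _))// ltrD//.
    exact: h fp pu _.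
  exact: h gq qv _.
apply: bigcup_measurable => k _; rewrite /A.
case: unpickle => // t; case: ifPn => // _.
by apply: measurableI; [apply: mf|apply: mg]; exact: ball_open.
Qed.

Lemma borel_measurableZ (a : R) f :
  borel_measurable f -> borel_measurable (a *: f)%R.
Proof.
move=> /borel_preimage mf; apply/borel_preimage => U oU.
apply: (mf ((fun v => a *: v) @^-1` U)).
by apply: open_comp => // v _; exact: scaler_continuous.
Qed.

Lemma borel_measurable0 : borel_measurable (0%R : Y -> V).
Proof. exact: measurable_cst. Qed.

End finite_dimensional_measurability.

Section Linfty.
Context {R : realType} {d : measure_display} {Y : measurableType d}.
Variables (mu : {measure set Y -> \bar R}) (V : finBanachType R).

Definition ess_bounded : {pred Y -> V} := fun f =>
  `[< borel_measurable f /\ ae_bounded mu f >].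

Lemma ae_boundedP (f : Y -> V) :
  ae_bounded mu f <-> exists M : R, {ae mu, forall y, `|f y| <= M}.
Proof.
split=> [/ess_supr_bounded//|[M fM]].
rewrite /ae_bounded (@le_lt_trans _ _ M%:E) ?ltry//.
by apply/ess_supP; move: fM; apply: filterS => y; rewrite lee_fin.
Qed.

Record Linfty_fun := LinftyFun
  { Linfty_fun_val :> Y -> V ; Linfty_funP : Linfty_fun_val \in ess_bounded }.

HB.instance Definition _ := [isSub for Linfty_fun_val].
HB.instance Definition _ := [Choice of Linfty_fun by <:].

Lemma ess_bounded_submod : submod_closed ess_bounded.
Proof.
split.
  apply/asboolP; split; first exact: borel_measurable0.
  by apply/ae_boundedP; exists 0; apply: aeW => y; rewrite normr0.
move=> a f g /asboolP[mf /ae_boundedP[M fM]] /asboolP[mg /ae_boundedP[N gN]].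
apply/asboolP; split.
  by apply: borel_measurableD => //; exact: borel_measurableZ.
apply/ae_boundedP; exists (`|a| * M + N); move: fM gN.
apply: filterS2 => y fM gN; rewrite (le_trans (ler_normD _ _))// lerD//.
by rewrite normrZ ler_wpM2l.
Qed.

HB.instance Definition _ :=
  GRing.isSubmodClosed.Build _ _ ess_bounded ess_bounded_submod.
HB.instance Definition _ := [SubChoice_isSubLmodule of Linfty_fun by <:].

Definition ae_null : {pred Linfty_fun} := fun f =>
  `[< {ae mu, forall y, f y = 0} >].

Lemma ae_null_submod : submod_closed ae_null.
Proof.
split; first by apply/asboolP; exact: aeW.
move=> a f g /asboolP f0 /asboolP g0; apply/asboolP; move: f0 g0.
apply: filterS2 => y /= fy gy; transitivity (a *: f y + g y) => //.
by rewrite fy gy scaler0 addr0.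
Qed.

HB.instance Definition _ :=
  GRing.isSubmodClosed.Build _ _ ae_null ae_null_submod.

(* Essentially bounded measurable functions modulo equality a.e. *)
Definition Linfty := Quotient.quot ae_null.

HB.instance Definition _ := Choice.on Linfty.
HB.instance Definition _ := EqQuotient.on Linfty.
HB.instance Definition _ := GRing.Zmodule.on Linfty.

Definition Linfty_class (f : Linfty_fun) : Linfty := \pi_Linfty%qT f.

Lemma Linfty_classP f g : Linfty_class f = Linfty_class g <->
  {ae mu, forall y, f y = g y}.
Proof.
rewrite (rwP eqP) -Quotient.idealrBE; split=> [/asboolP|fg].
  by apply: filterS => y /= /eqP; rewrite subr_eq0 => /eqP.
apply/asboolP; move: fg; apply: filterS => y /= fgy.
by transitivity (f y - g y) => //; rewrite fgy subrr.
Qed.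

Let classD f g : Linfty_class (f + g) = Linfty_class f + Linfty_class g.
Proof. by rewrite /Linfty_class !piE. Qed.

Definition Linfty_repr (q : Linfty) : Linfty_fun := repr q.

Let repK (q : Linfty) : Linfty_class (Linfty_repr q) = q.
Proof. exact: reprK. Qed.

Definition Linfty_scale (a : R) (q : Linfty) : Linfty :=
  Linfty_class (a *: Linfty_repr q).

Let classZ a f : Linfty_class (a *: f) = Linfty_scale a (Linfty_class f).
Proof.
apply/Linfty_classP; have /Linfty_classP := repK (Linfty_class f).
apply: filterS => y fy; transitivity (a *: f y) => //.
by rewrite -fy.
Qed.

Let scaleA a b q : Linfty_scale a (Linfty_scale b q) = Linfty_scale (a * b) q.
Proof. by rewrite -[q]repK -!classZ scalerA. Qed.

Let scale1 : left_id 1 Linfty_scale.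
Proof. by move=> q; rewrite -[q]repK -!classZ scale1r. Qed.

Let scaleDr : right_distributive Linfty_scale +%R.
Proof.
by move=> a p q; rewrite -[p]repK -[q]repK -classD -!classZ -classD scalerDr.
Qed.

Let scaleDl q : {morph Linfty_scale^~ q : a b / a + b}.
Proof. by move=> a b; rewrite -[q]repK -!classZ -classD scalerDl. Qed.

HB.instance Definition _ :=
  GRing.Zmodule_isLmodule.Build R Linfty scaleA scale1 scaleDr scaleDl.

Lemma Linfty_class_linear : linear Linfty_class.
Proof. by move=> a f g; rewrite classD classZ. Qed.

HB.instance Definition _ :=
  GRing.isLinear.Build R Linfty_fun Linfty _ Linfty_class Linfty_class_linear.

(* If mu is the zero measure then ess_sup is -oo, and fine maps it to 0. *)
Definition Linfty_norm (q : Linfty) : R :=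
  fine (ess_sup mu (fun y => `|Linfty_repr q y|%:E)).

Lemma ae_le_Linfty_norm q :
  {ae mu, forall y, `|Linfty_repr q y| <= Linfty_norm q}.
Proof.
have [_] := asboolP _ (Linfty_funP (Linfty_repr q)).
rewrite /Linfty_norm /ae_bounded -/(Linfty_repr q); set s := ess_sup _ _ => soo.
have : {ae mu, forall y, (`|Linfty_repr q y|%:E <= s)%E} by exact: ess_sup_ge.
apply: filterS => y; case: s soo => [s|//|] _; first by rewrite lee_fin.
by rewrite leeNy_eq.
Qed.

Lemma Linfty_norm_ge0 q : 0 <= Linfty_norm q.
Proof.
rewrite /Linfty_norm; have [mu0|] := boolP (0 < mu setT)%E.
  by apply: fine_ge0; apply: ess_sup_ger => // y; exact: normr_ge0.
rewrite lt0e measure_ge0 andbT negbK => /eqP mu0.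
suff -> : ess_sup mu (fun y => `|Linfty_repr q y|%:E) = -oo%E by [].
by apply/ess_sup_eqNyP; exists setT; split.
Qed.

Lemma Linfty_norm_le q (M : R) : 0 <= M ->
  {ae mu, forall y, `|Linfty_repr q y| <= M} -> Linfty_norm q <= M.
Proof.
move=> M0 qM; rewrite /Linfty_norm.
have : (ess_sup mu (fun y => `|Linfty_repr q y|%:E) <= M%:E)%E.
  by apply/ess_supP; move: qM; apply: filterS => y; rewrite lee_fin.
by case: ess_sup => [r|//|//]; rewrite lee_fin.
Qed.

Let repD p q : {ae mu, forall y,
  Linfty_repr (p + q) y = Linfty_repr p y + Linfty_repr q y}.
Proof.
apply/(Linfty_classP _ (Linfty_repr p + Linfty_repr q)).
by rewrite classD !repK.
Qed.

Let repZ a q : {ae mu, forall y, Linfty_repr (a *: q) y = a *: Linfty_repr q y}.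
Proof.
by apply/(Linfty_classP _ (a *: Linfty_repr q)); rewrite classZ !repK.
Qed.

Let normD p q : Linfty_norm (p + q) <= Linfty_norm p + Linfty_norm q.
Proof.
apply: Linfty_norm_le; first by rewrite addr_ge0// Linfty_norm_ge0.
move: (repD p q) (ae_le_Linfty_norm p) (ae_le_Linfty_norm q).
apply: filterS3 => y -> py qy.
by rewrite (le_trans (ler_normD _ _))// lerD.
Qed.

Let normZ a q : Linfty_norm (a *: q) = `|a| * Linfty_norm q.
Proof.
have le c p : Linfty_norm (c *: p) <= `|c| * Linfty_norm p.
  apply: Linfty_norm_le; first by rewrite mulr_ge0// Linfty_norm_ge0.
  move: (repZ c p) (ae_le_Linfty_norm p); apply: filterS2 => y -> py.
  by rewrite normrZ ler_wpM2l.
apply/eqP; rewrite eq_le le//=.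
have [->|a0] := eqVneq a 0; first by rewrite normr0 mul0r Linfty_norm_ge0.
by rewrite -ler_pdivlMl ?normr_gt0// -normfV -{1}[q](scalerK a0) le.
Qed.

Let norm_eq0 q : Linfty_norm q = 0 -> q = 0.
Proof.
move=> q0; rewrite -[q]repK -(linear0 Linfty_class).
apply/Linfty_classP; move: (ae_le_Linfty_norm q).
by apply: filterS => y; rewrite q0 normr_le0 => /eqP.
Qed.

HB.instance Definition _ :=
  Lmodule_isNormed.Build R Linfty normD normZ norm_eq0.

End Linfty.

(* Images of bounded sets are relatively compact. *)
Definition compact_operator (R : realType) (V W : normedModType R)
    (F : {linear V -> W}) :=
  forall A : set V, bounded_set A -> compact (closure (F @` A)).

(* Main.v *)
Require Import Defs.
From HB Require Import structures.
From mathcomp Require Import all_boot all_order all_algebra.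
From mathcomp Require finmap.
From mathcomp Require Import all_classical all_reals all_analysis.
From mathcomp Require Import measurable_realfun ring.
Set Implicit Arguments.
Unset Strict Implicit.
Unset Printing Implicit Defensive.

Import VectorInternalTheory.
Import Order.TTheory GRing.Theory Num.Theory.
Import numFieldNormedType.Exports.
Local Open Scope classical_set_scope.
Local Open Scope ring_scope.

(** The kernel is a map x |-> K(x, .) from X to L^1(Y, B(E)), and the whole
    proof is that this map is continuous with totally bounded range.

    Continuity ([kernel_dist_near]) is dominated convergence: the local
    majorant D_x dominates K(z, .) for z near x, and K(., y) is continuous.

    Total boundedness ([kernel_totally_bounded]) combines continuity on a
    compact ball with (K1) outside of it. Let T bound all the T_v. If
    |x| > T and v = x / |x|, then K(x, .) and K(T v, .) are both close to L_v,
    hence close to each other, so that a finite net for the image of the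
    closed ball of radius T is a slightly coarser net for the whole range.
    The comparison is made on each ray separately, so it does not matter how
    L_v varies with v.

    For |f| <= M almost everywhere, F f is bounded by a multiple of M and
      |F f(x) - F f(z)| <= const * M * ||K(x, .) - K(z, .)||_1.
    The images of a bounded set of functions f thus share one bound and one
    modulus of continuity with respect to a pseudometric for which X is
    totally bounded, and an Arzela-Ascoli argument ([ascoli]) shows that the
    bounded continuous functions with such a bound and modulus form a compact
    set.

    Two reductions make this concrete. Integrals of functions with values in a
    finite-dimensional space are computed coordinatewise, and agree with the
    Bochner integral ([bochner_integralE]). The operator norm is replaced by
    the equivalent norm A |-> sum_i |A e_i|, where (e_i) is a basis: it
    makes the distance between two measurable kernels visibly measurable. All
    constants relating the norms are harmless, since only boundedness and
    compactness are at stake. *)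

(** * Norms and coordinates in finite dimension *)

Section coordinates.
Context {R : realType} {V : finBanachType R}.
Implicit Types (v : V).

Definition basis_vector (i : 'I_(dim V)) : V := r2v (delta_mx 0 i).

Lemma v2r_sum v : v = \sum_i v2r v 0 i *: basis_vector i.
Proof.
rewrite -[LHS]v2rK {1}(row_sum_delta (v2r v)) linear_sum.
by apply: eq_bigr => i _; rewrite linearZ.
Qed.

Lemma r2v_sum (a : 'rV[R]_(dim V)) : r2v a = \sum_i a 0 i *: basis_vector i.
Proof. by rewrite [LHS]v2r_sum r2vK. Qed.

Lemma coord_le_norm (m : nat) (a : 'rV[R]_m) i : `|a 0 i| <= `|a|.
Proof.
rewrite [leRHS]/Num.norm/= mx_normrE.
by apply: (le_bigmax _ (fun ij : 'I_1 * 'I_m => `|a ij.1 ij.2|) (0, i)).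
Qed.

Lemma r2v_continuous : continuous (r2v : 'rV[R]_(dim V) -> V).
Proof.
apply: bounded_linear_continuous; apply/bounded_funP => r.
exists (\sum_i r * `|basis_vector i|) => a ar.
rewrite /= r2v_sum (le_trans (ler_norm_sum _ _ _))//.
apply: ler_sum => i _; rewrite normrZ ler_wpM2r//.
exact: (le_trans (coord_le_norm a i) ar).
Qed.

(** All norms on a finite-dimensional space are equivalent. The sphere of the
    max-norm of coordinates is compact, hence so is its image in [V]; that image
    avoids 0, so it stays outside some ball around 0. *)
Lemma v2r_bounded : exists2 M : R, 0 < M & forall v, `|v2r v| <= M * `|v|.
Proof.
pose S := [set a : 'rV[R]_(dim V) | `|a| = 1].
have cS : compact S.
  apply: bounded_closed_compact.
    exists 1; split => // x x1 a Sa.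
    by apply: le_trans (ltW x1); rewrite Sa.
  apply: (@closed_comp _ _ (Num.norm : 'rV[R]_(dim V) -> R) [set 1]).
    by move=> a _; exact: norm_continuous.
  exact: closed_eq.
have : nbhs (0 : V) (~` (r2v @` S)).
  apply: open_nbhs_nbhs; split.
    apply: closed_openC; apply: compact_closed; first exact: norm_hausdorff.
    apply: continuous_compact => //; apply: continuous_subspaceT.
    exact: r2v_continuous.
  move=> [a Sa /(congr1 v2r)]; rewrite r2vK linear0 => a0.
  by move: Sa; rewrite /S/= a0 normr0 => /esym/eqP; rewrite oner_eq0.
move=> /nbhs_ballP[e /= e0 eS]; exists e^-1; first by rewrite invr_gt0.
move=> v; have [->|v0] := eqVneq (v2r v) 0.
  by rewrite normr0 mulr_ge0// invr_ge0 ltW.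
rewrite ler_pdivlMl// leNgt; apply/negP => vv.
have a0 : 0 < `|v2r v| by rewrite normr_gt0.
apply: (eS (`|v2r v|^-1 *: v)).
  rewrite -ball_normE/= sub0r normrN normrZ normfV normr_id.
  by rewrite ltr_pdivrMl// mulrC.
exists (`|v2r v|^-1 *: v2r v); last by rewrite linearZ/= v2rK.
by rewrite /S/= normrZ normfV normr_id mulVf// gt_eqF.
Qed.

Definition coord_bound : R := sval (cid2 v2r_bounded).

Lemma coord_bound_gt0 : 0 < coord_bound.
Proof. by rewrite /coord_bound; case: cid2. Qed.

Lemma norm_v2r v : `|v2r v| <= coord_bound * `|v|.
Proof. by rewrite /coord_bound; case: cid2. Qed.

Lemma norm_coord v i : `|v2r v 0 i| <= coord_bound * `|v|.
Proof. exact: le_trans (coord_le_norm _ i) (norm_v2r v). Qed.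

Lemma v2r_continuous : continuous (v2r : V -> 'rV[R]_(dim V)).
Proof.
apply: bounded_linear_continuous; apply/bounded_funP => r.
exists (coord_bound * r) => a ar.
by rewrite (le_trans (norm_v2r a))// ler_wpM2l// ltW// coord_bound_gt0.
Qed.

Lemma coordinate_continuous i : continuous (fun v : V => v2r v 0 i).
Proof.
move=> v; apply: (@continuous_comp _ _ _ v2r (fun a : 'rV[R]_(dim V) => a 0 i)).
  exact: v2r_continuous.
exact: coord_continuous.
Qed.

(** Heine-Borel, transported from row vectors. *)
Lemma closed_ball_compact (r : R) : compact [set v : V | `|v| <= r].
Proof.
rewrite (_ : mkset _ = r2v @` [set a | `|r2v a : V| <= r]); last first.
  apply/seteqP; split=> [v vr|_ [a ar <-]//].
  by exists (v2r v); rewrite /= v2rK.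
apply: continuous_compact.
  exact/continuous_subspaceT/r2v_continuous.
apply: bounded_closed_compact.
  exists (coord_bound * r); split; first exact: num_real.
  move=> x rx a /= ar.
  rewrite -[a]r2vK (le_trans (norm_v2r _))// (le_trans _ (ltW rx))//.
  by rewrite ler_wpM2l// ltW// coord_bound_gt0.
rewrite (_ : mkset _ = (fun a => `|r2v a : V|) @^-1` [set x | x <= r])//.
apply: closed_comp => [a _|]; last exact: closed_le.
apply: continuous_comp; first exact: r2v_continuous.
exact: norm_continuous.
Qed.

End coordinates.
Arguments coord_bound {R} V.

(** * Coordinatewise and Bochner integrals *)

Section borel_coordinates.
Context {R : realType} {d : measure_display} {Y : measurableType d}.

Lemma borel_measurable_comp (V W : normedModType R) (h : V -> W) (f : Y -> V) :
  continuous h -> borel_measurable f -> borel_measurable (h \o f).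
Proof.
move=> /continuousP ch /borel_preimage mf; apply/borel_preimage => U oU.
exact: mf (ch _ oU).
Qed.

Lemma borel_measurable_real (V : normedModType R) (h : V -> R) (f : Y -> V) :
  continuous h -> borel_measurable f -> measurable_fun [set: Y] (h \o f).
Proof.
move=> /continuousP ch /borel_preimage mf.
apply: (measurability _ (RGenOpens.measurableE R)).
move=> _ [_ [a [b ->] <-]]; rewrite setTI.
exact: mf (ch _ (interval_open _ _)).
Qed.

Lemma measurable_norm (V : normedModType R) (f : Y -> V) :
  borel_measurable f -> measurable_fun [set: Y] (fun y => `|f y|).
Proof. by apply: borel_measurable_real; exact: norm_continuous. Qed.

Lemma borel_measurable_coord (V : finBanachType R) (f : Y -> V) :
  borel_measurable f <->
  forall i, measurable_fun [set: Y] (fun y => v2r (f y) 0 i).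
Proof.
split=> [mf i|mf].
  apply: (@borel_measurable_real V (fun v => v2r v 0 i)) => //.
  exact: coordinate_continuous.
have -> : f = \sum_i (fun y => v2r (f y) 0 i *: basis_vector i).
  by apply/funext => y; rewrite fct_sumE -v2r_sum.
elim/big_ind: _ => [|g h mg mh|i _].
- exact: borel_measurable0.
- exact: borel_measurableD.
apply/borel_preimage => U oU; rewrite -[X in measurable X]setTI.
apply: (mf i measurableT ((fun r => r *: basis_vector i) @^-1` U)).
apply: open_measurable; apply: open_comp => // r _; exact: scalel_continuous.
Qed.

End borel_coordinates.

(** The integral of a nonnegative function is a supremum over the simple
    functions below it, hence monotone without any measurability. This form
    serves for operator norms of differences of kernels, whose measurability
    would otherwise have to be established first. *)
Lemma ge0_le_integral_nonmeasurable (R : realType) (d : measure_display)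
    (Y : measurableType d) (mu : {measure set Y -> \bar R})
    (f g : Y -> \bar R) :
  (forall y, 0 <= f y)%E -> (forall y, f y <= g y)%E ->
  (\int[mu]_y f y <= \int[mu]_y g y)%E.
Proof.
move=> f0 fg; have g0 y : (0 <= g y)%E by exact: le_trans (f0 y) (fg y).
rewrite !ge0_integralTE//; apply: ereal_sup_le => _ [h hf <-].
by exists h => // y; exact: le_trans (hf y) (fg y).
Qed.

Lemma L1_fun_norm (R : realType) (d : measure_display) (Y : measurableType d)
    (mu : {measure set Y -> \bar R}) (V : normedModType R) (f : Y -> V) :
  L1_fun mu f -> mu.-integrable [set: Y] (EFin \o (fun y => `|f y|)).
Proof.
move=> [mf foo]; apply/integrableP; split.
  by apply/measurable_EFinP; exact: measurable_norm.
by under eq_integral do rewrite /= normr_id.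
Qed.

Section vector_integral.
Context {R : realType} {d : measure_display} {Y : measurableType d}.
Context {mu : {measure set Y -> \bar R}} {V : finBanachType R}.
Implicit Types (f g s : Y -> V).

Lemma L1_funP f : L1_fun mu f <->
  forall i, mu.-integrable [set: Y] (fun y => (v2r (f y) 0 i)%:E).
Proof.
split=> [[mf foo] i|intf].
  apply/integrableP; split.
    by apply/measurable_EFinP; move/borel_measurable_coord: mf.
  apply: (@le_lt_trans _ _ (\int[mu]_y ((coord_bound V)%:E * `|f y|%:E))%E).
    apply: ge0_le_integral_nonmeasurable => // y.
    by rewrite /= -EFinM lee_fin norm_coord.
  rewrite ge0_integralZl_EFin//; last 2 first.
  - by apply/measurable_EFinP; exact: measurable_norm.
  - by rewrite ltW// coord_bound_gt0.
  by rewrite lte_mul_pinfty// ?lee_fin ltW// coord_bound_gt0.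
have mf : borel_measurable f.
  apply/borel_measurable_coord => i.
  by apply/measurable_EFinP; exact: measurable_int (intf i).
split => //.
apply: (@le_lt_trans _ _ (\int[mu]_y
    (\sum_i `|basis_vector i : V|%:E * (`|v2r (f y) 0 i|)%:E))%E).
  apply: ge0_le_integral_nonmeasurable => // y.
  rewrite [in leLHS](v2r_sum (f y)).
  under [leRHS]eq_bigr do rewrite -EFinM.
  rewrite sumEFin lee_fin (le_trans (ler_norm_sum _ _ _))// ler_sum// => i _.
  by rewrite normrZ mulrC.
apply: integrable_lty => //; apply: integrable_sum => // i _.
exact: (integrableZl measurableT _
  (@integrable_norm _ _ _ _ _ (fun y => v2r (f y) 0 i) (intf i))).
Qed.

Lemma L1_fun_lin (a : R) f g :
  L1_fun mu f -> L1_fun mu g -> L1_fun mu (a *: f + g).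
Proof.
move=> /L1_funP intf /L1_funP intg; apply/L1_funP => i.
rewrite (_ : (fun y => _) =
    ((fun y => a%:E * (v2r (f y) 0 i)%:E) \+ (fun y => (v2r (g y) 0 i)%:E))%E).
  by apply: integrableD => //; exact: integrableZl.
by apply/funext => y; rewrite linearP !mxE.
Qed.

Lemma L1_funB f g : L1_fun mu f -> L1_fun mu g -> L1_fun mu (f - g).
Proof.
move=> Lf Lg; have -> : f - g = (-1) *: g + f by rewrite scaleN1r addrC.
exact: L1_fun_lin.
Qed.

Definition vector_integral f : V :=
  r2v (\row_i (\int[mu]_y (v2r (f y) 0 i))).

Lemma vector_integral_coord f i :
  v2r (vector_integral f) 0 i = \int[mu]_y (v2r (f y) 0 i).
Proof. by rewrite r2vK mxE. Qed.

Lemma vector_integral_lin (a : R) f g : L1_fun mu f -> L1_fun mu g ->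
  vector_integral (a *: f + g) = a *: vector_integral f + vector_integral g.
Proof.
move=> /L1_funP intf /L1_funP intg; apply: (can_inj v2rK); apply/rowP => i.
rewrite linearP !mxE !vector_integral_coord.
rewrite -RintegralZl//; last exact: intf.
rewrite -RintegralD//; last exact: intg.
  by apply: eq_Rintegral => y _; rewrite linearP !mxE.
exact: (integrableZl measurableT a (intf i)).
Qed.

Lemma vector_integralB f g : L1_fun mu f -> L1_fun mu g ->
  vector_integral (f - g) = vector_integral f - vector_integral g.
Proof.
move=> Lf Lg.
have -> : f - g = (-1) *: g + f by rewrite scaleN1r addrC.
by rewrite vector_integral_lin// scaleN1r addrC.
Qed.

Lemma ae_eq_vector_integral f g : L1_fun mu f -> L1_fun mu g ->
  {ae mu, forall y, f y = g y} -> vector_integral f = vector_integral g.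
Proof.
move=> /L1_funP intf /L1_funP intg fg; congr r2v; apply/rowP => i; rewrite !mxE.
congr fine; apply: ae_eq_integral => //.
- exact: measurable_int (intf i).
- exact: measurable_int (intg i).
by apply: filterS fg => y -> _.
Qed.

Definition vector_integral_bound : R :=
  \sum_(i < dim V) coord_bound V * `|basis_vector i : V|.

Lemma vector_integral_bound_ge0 : 0 <= vector_integral_bound.
Proof. by apply: sumr_ge0 => i _; rewrite mulr_ge0// ltW// coord_bound_gt0. Qed.

(** The sharp constant is 1; the one obtained by summing over coordinates is
    enough for limits and compactness. *)
Lemma norm_vector_integral f : L1_fun mu f ->
  `|vector_integral f| <= vector_integral_bound * \int[mu]_y `|f y|.
Proof.
move=> Lf; have /L1_funP intf := Lf; have nf := L1_fun_norm Lf.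
rewrite [vector_integral f]v2r_sum (le_trans (ler_norm_sum _ _ _))//.
rewrite mulr_suml; apply: ler_sum => i _.
rewrite normrZ mulrAC ler_wpM2r// vector_integral_coord.
rewrite (le_trans (le_normr_Rintegral _ _))//; first exact: intf.
rewrite -RintegralZl//; apply: le_Rintegral => //.
- exact: (@integrable_norm _ _ _ _ _ (fun y => v2r (f y) 0 i) (intf i)).
- exact: (integrableZl measurableT _ nf).
by move=> y _; exact: norm_coord.
Qed.

End vector_integral.
Arguments vector_integral {R d Y} mu {V} f.
Arguments vector_integral_bound {R} V.

Section simple_functions.
Context {R : realType} {d : measure_display} {Y : measurableType d}.
Context {mu : {measure set Y -> \bar R}} {V : finBanachType R}.
Implicit Types (f g s : Y -> V).

Lemma measurable_fibre f v : borel_measurable f ->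
  measurable (f @^-1` [set v]).
Proof.
move=> /borel_preimage mf; rewrite -[X in measurable X]setCK preimage_setC.
apply/measurableC/mf/closed_openC.
by apply: compact_closed; [exact: norm_hausdorff|exact: compact_set1].
Qed.

(** Markov's inequality on one fibre: [f] has constant norm [`|v| > 0] there. *)
Lemma L1_fun_fibre f v : L1_fun mu f -> v != 0 ->
  (mu (f @^-1` [set v]) < +oo)%E.
Proof.
move=> [mf foo] v0; have mfv := measurable_fibre v mf.
have nv0 : 0 < `|v| by rewrite normr_gt0.
have : (`|v|%:E * mu (f @^-1` [set v]) < +oo)%E.
  rewrite -(integral_cst mu mfv); apply: le_lt_trans foo.
  rewrite (_ : integral _ _ _ = \int[mu]_(y in f @^-1` [set v]) `|f y|%:E)%E.
    apply: ge0_subset_integral => //.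
    by apply/measurable_EFinP; exact: measurable_norm.
  by apply: eq_integral => y; rewrite inE /= => <-.
rewrite [in X in _ -> X]ltey; apply: contraTN => /eqP ->.
by rewrite mulry gtr0_sg// mul1e.
Qed.

Lemma integrable_indic_finite (A : set Y) : measurable A ->
  (mu A < +oo)%E -> mu.-integrable [set: Y] (fun y => (\1_A y)%:E).
Proof.
move=> mA Aoo; apply/integrableP; split.
  by apply/measurable_EFinP; exact: measurable_indic.
under eq_integral do rewrite gee0_abs ?lee_fin//.
by rewrite integral_indic// setIT.
Qed.

Lemma simple_fun_coord s i y : finite_set (range s) ->
  v2r (s y) 0 i =
  \sum_(v <- finmap.enum_fset (fset_set (range s)))
    v2r v 0 i * \1_(s @^-1` [set v]) y.
Proof.
move=> fs; rewrite (finmap.big_fsetD1 (s y))/=; last first.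
  by rewrite in_fset_set// inE; exists y.
rewrite indicE mem_set// mulr1 big_seq big1 ?addr0// => v.
rewrite finmap.in_fsetD1 => /andP[vs _].
by rewrite indicE memNset ?mulr0// => /= sv; rewrite sv eqxx in vs.
Qed.

Lemma simple_fun_term_integrable s v i : simple_fun mu s ->
  mu.-integrable [set: Y]
    (fun y => (v2r v 0 i)%:E * (\1_(s @^-1` [set v]) y)%:E)%E.
Proof.
move=> [_ ms fins]; have [->|v0] := eqVneq v 0.
  rewrite linear0 mxE (_ : (fun y => _) = cst 0%E); first exact: integrable0.
  by apply/funext => y; rewrite mul0e.
by apply: integrableZl => //; apply: integrable_indic_finite => //; exact: fins.
Qed.

Lemma simple_fun_L1 s : simple_fun mu s -> L1_fun mu s.
Proof.
move=> ss; apply/L1_funP => i; have [fs _ _] := ss.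
under eq_fun do rewrite simple_fun_coord// -sumEFin.
under eq_fun do under eq_bigr do rewrite EFinM.
apply: integrable_sum => // v _; exact: simple_fun_term_integrable.
Qed.

Lemma simple_integralE s : simple_fun mu s ->
  simple_integral mu s = vector_integral mu s.
Proof.
move=> ss; have [fs ms fins] := ss; apply: (can_inj v2rK); apply/rowP => i.
rewrite vector_integral_coord /simple_integral fsbig_finite//=.
rewrite linear_sum summxE /Rintegral.
rewrite (_ : integral _ _ _ = \sum_(v <- finmap.enum_fset (fset_set (range s)))
    (fine (mu (s @^-1` [set v])) * v2r v 0 i)%:E)%E.
  by rewrite sumEFin; apply: eq_bigr => v _; rewrite linearZ mxE.
under eq_integral do rewrite simple_fun_coord// -sumEFin.
under eq_integral do under eq_bigr do rewrite EFinM.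
rewrite integral_sum//; last by move=> v; exact: simple_fun_term_integrable.
apply: eq_bigr => v _; have [->|v0] := eqVneq v 0.
  rewrite linear0 mxE mulr0; under eq_integral do rewrite mul0e.
  exact: integral0.
rewrite integralZl//; last exact: integrable_indic_finite (fins v v0).
rewrite integral_indic// setIT mulrC EFinM fineK//.
by rewrite ge0_fin_numE// fins.
Qed.

End simple_functions.

Section bochner.
Import HBSimple.
Context {R : realType} {d : measure_display} {Y : measurableType d}.
Context {mu : {measure set Y -> \bar R}} {V : finBanachType R}.
Implicit Types (f g s : Y -> V).

Lemma cvg_vector_integral f (s : (Y -> V)^nat) :
  L1_fun mu f -> (forall n, L1_fun mu (s n)) ->
  (\int[mu]_y `|f y - s n y|%:E @[n --> \oo] --> 0)%E ->
  vector_integral mu (s n) @[n --> \oo] --> vector_integral mu f.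
Proof.
move=> Lf Ls /fine_cvgP[_ fs0]; apply/cvgrPdist_le => e e0.
have : vector_integral_bound V * \int[mu]_y `|f y - s n y| @[n --> \oo] --> 0.
  by rewrite -(mulr0 (vector_integral_bound V)); apply: cvgMr.
move=> /cvgrPdist_le/(_ e e0); apply: filterS => n; rewrite sub0r normrN => sn.
have Lfs : L1_fun mu (f - s n) by exact: L1_funB.
rewrite -vector_integralB// (le_trans (norm_vector_integral Lfs))//.
exact: le_trans (ler_norm _) sn.
Qed.

(** Approximate each coordinate in mean by real simple functions. *)
Lemma simple_fun_dense f : L1_fun mu f -> exists s : (Y -> V)^nat,
  (forall n, simple_fun mu (s n)) /\
  (\int[mu]_y `|f y - s n y|%:E @[n --> \oo] --> 0)%E.
Proof.
move=> Lf; have /L1_funP intf := Lf; have [mf _] := Lf.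
have /(_ _)/cid-/all_sig[g gP] i :=
  approximation_sfun_integrable measurableT (intf i).
pose s n y : V := \sum_i g i n y *: basis_vector i.
have sE n y i : v2r (s n y) 0 i = g i n y.
  rewrite (_ : s n y = r2v (\row_i g i n y)) ?r2vK ?mxE// r2v_sum.
  by apply: eq_bigr => j _; rewrite mxE.
have Ls n : L1_fun mu (s n).
  apply/L1_funP => i; have [intg _ _] := gP i.
  by under eq_fun do rewrite sE; exact: intg.
exists s; split=> [n|].
  split=> [|v|v v0]; last exact: L1_fun_fibre.
    have -> : s n = \sum_i (fun y => g i n y *: basis_vector i).
      by apply/funext => y; rewrite fct_sumE.
    elim/big_ind: _ => [|h k fh fk|i _].
    - by apply: (sub_finite_set _ (finite_set1 0)) => _ [y _ <-].
    - exact: (finite_image11 +%R fh fk).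
    - have := @fimfunP _ _ (g i n).
      move=> /(finite_image (fun r => r *: (basis_vector i : V))).
      by rewrite image_comp.
  by apply: measurable_fibre; have [] := Ls n.
apply: (@squeeze_cvge _ _ _ _ (cst 0%E) _ (fun n => \sum_i
   (`|basis_vector i : V|%:E *
    \int[mu]_y `|(v2r (f y) 0 i)%:E - (g i n y)%:E|))%E).
- apply: nearW => n; rewrite integral_ge0//=.
  have -> : (\sum_i `|basis_vector i : V|%:E *
      \int[mu]_y `|(v2r (f y) 0 i)%:E - (g i n y)%:E| =
      \int[mu]_y \sum_i (`|basis_vector i : V|%:E *
        `|(v2r (f y) 0 i)%:E - (g i n y)%:E|))%E.
    have mfg i : measurable_fun [set: Y]
        (fun y => `|(v2r (f y) 0 i)%:E - (g i n y)%:E|)%E.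
      have [intg _ _] := gP i; apply: measurableT_comp => //.
      exact: measurable_int (integrableB measurableT (intf i) (intg n)).
    rewrite ge0_integral_sum//; last by move=> i; exact: emeasurable_funM.
    by apply: eq_bigr => i _; rewrite ge0_integralZl_EFin.
  apply: ge0_le_integral_nonmeasurable => // y.
  rewrite [f y - s n y]v2r_sum.
  under eq_bigr do rewrite linearB !mxE sE.
  under [leRHS]eq_bigr do rewrite -EFinB abse_EFin -EFinM.
  rewrite sumEFin lee_fin (le_trans (ler_norm_sum _ _ _))// ler_sum// => i _.
  by rewrite normrZ mulrC.
- exact: cvg_cst.
rewrite [X in _ --> X](_ : _ =
  \sum_(i < dim V) `|basis_vector i : V|%:E * 0)%E; last first.
  by rewrite big1// => i _; rewrite mule0.
apply: cvg_nnesum => i _.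
  by apply: nearW => n; rewrite mule_ge0// integral_ge0.
by apply: cvgeZl => //; have [] := gP i.
Qed.

Lemma is_bochner_vector_integral f : L1_fun mu f ->
  is_bochner_integral mu f (vector_integral mu f).
Proof.
move=> Lf; have [s [ss sf]] := simple_fun_dense Lf; exists s; split => //.
under eq_fun do rewrite simple_integralE//.
by apply: cvg_vector_integral => // n; exact: simple_fun_L1.
Qed.

(** The approximating sequence in the definition of the Bochner integral is
    arbitrary; as the coordinatewise integral is continuous for convergence in
    mean, every such sequence leads to the same limit. *)
Lemma bochner_integralE f : L1_fun mu f ->
  bochner_integral mu f = vector_integral mu f.
Proof.
move=> Lf; rewrite /bochner_integral; case: xgetP => [v _ [s [ss sf sv]]|].
  have := @cvg_vector_integral f s Lf (fun n => simple_fun_L1 (ss n)) sf.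
  under eq_fun do rewrite -simple_integralE//.
  move=> sf'; apply: cvg_unique sv sf'; exact: norm_hausdorff.
by move=> /(_ (vector_integral mu f)); case; exact: is_bochner_vector_integral.
Qed.

End bochner.

(** * Bounded operators and measurable kernels *)

Section bop_norm.
Context {R : realType} {V W : normedModType R}.
Implicit Types (A B : bop V W).

Fact bop_is_linear A : linear A.
Proof. by have [] := asboolP _ (bopP A). Qed.

HB.instance Definition _ A :=
  GRing.isLinear.Build R V W *:%R (bop_fun A) (bop_is_linear A).

Lemma bopB A B u : (A - B) u = A u - B u.
Proof. by []. Qed.

Lemma norm_bop A u : `|A u| <= `|A| * `|u|.
Proof.
have [_ [M AM]] := asboolP _ (bopP A).
have [->|u0] := eqVneq u 0; first by rewrite linear0 !normr0 mulr0.
have nu : 0 < `|u| by rewrite normr_gt0.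
have : `|A (`|u|^-1 *: u)| <= `|A|.
  apply: sup_norm_ub => /=; last first.
    by rewrite normrZ normfV normr_id mulVf// gt_eqF.
  exists `|M| => x /= x1; rewrite (le_trans (AM x))// (le_trans (ler_norm _))//.
  by rewrite normrM normr_id ler_piMr.
by rewrite linearZ/= normrZ normfV normr_id ler_pdivrMl// mulrC.
Qed.

Lemma bop_eval_continuous u : continuous (fun A : bop V W => A u).
Proof.
move=> A; apply/(@cvgrPdist_lt _ _ _ (nbhs A)) => e e0.
apply/nbhs_ballP; exists (e / (`|u| + 1)) => /=.
  by rewrite divr_gt0// ltr_wpDl.
move=> B; rewrite -ball_normE/= ltr_pdivlMr ?ltr_wpDl// => ABe.
rewrite -bopB (le_lt_trans (norm_bop _ _))// (le_lt_trans _ ABe)//.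
by rewrite ler_wpM2l// lerDl.
Qed.

End bop_norm.

Section bop_basis_norm.
Context {R : realType} {V : finBanachType R} {W : normedModType R}.
Implicit Types (A B : bop V W).

(** A norm equivalent to the operator norm. Contrary to the latter, it is a
    finite sum of norms of evaluations, so that it is measurable along the
    difference of two measurable kernels without any separability argument for
    the space of operators. *)
Definition basis_norm A : R := \sum_i `|A (basis_vector i)|.

(** The summand 1 makes this constant invertible, also in dimension 0. *)
Definition basis_bound : R := 1 + \sum_(i < dim V) `|basis_vector i : V|.

Lemma basis_bound_gt0 : 0 < basis_bound.
Proof. by rewrite ltr_pwDl// sumr_ge0. Qed.

Lemma basis_norm_ge0 A : 0 <= basis_norm A.
Proof. exact: sumr_ge0. Qed.

Lemma basis_norm_le A : basis_norm A <= basis_bound * `|A|.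
Proof.
rewrite mulrDl mul1r ler_wpDl// mulr_suml; apply: ler_sum => i _.
by rewrite mulrC norm_bop.
Qed.

Lemma basis_normB A B C :
  basis_norm (A - C) <= basis_norm (A - B) + basis_norm (B - C).
Proof.
rewrite -big_split; apply: ler_sum => i _.
exact: (ler_distD (B (basis_vector i)) (A _) (C _)).
Qed.

Lemma basis_normC A B : basis_norm (A - B) = basis_norm (B - A).
Proof. by apply: eq_bigr => i _; rewrite !bopB distrC. Qed.

Lemma norm_bop_basis A u :
  `|A u| <= coord_bound V * `|u| * basis_norm A.
Proof.
rewrite {1}(v2r_sum u) linear_sum (le_trans (ler_norm_sum _ _ _))//.
rewrite mulr_sumr; apply: ler_sum => i _.
by rewrite linearZ/= normrZ ler_wpM2r// norm_coord.
Qed.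

End bop_basis_norm.
Arguments basis_bound {R} V.

Section kernel_measurability.
Context {R : realType} {d : measure_display} {Y : measurableType d}.
Context {V W : finBanachType R}.

Lemma measurable_basis_normB (A B : Y -> bop V W) :
  borel_measurable A -> borel_measurable B ->
  measurable_fun [set: Y] (fun y => basis_norm (A y - B y)).
Proof.
move=> mA mB; apply: measurable_sum => i; apply: measurable_norm.
have mC (C : Y -> bop V W) : borel_measurable C ->
    borel_measurable (fun y => C y (basis_vector i)).
  exact: borel_measurable_comp (@bop_eval_continuous _ _ _ _).
have -> : (fun y => (A y - B y) (basis_vector i)) =
    (fun y => A y (basis_vector i)) +
    (-1 : R) *: (fun y => B y (basis_vector i)).
  by apply/funext => y; rewrite bopB /= scaleN1r.
by apply: borel_measurableD; [exact: mC|apply: borel_measurableZ; exact: mC].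
Qed.

(** In coordinates, [A y (f y)] is a matrix-vector product. *)
Lemma borel_measurable_bop (A : Y -> bop V W) (f : Y -> V) :
  borel_measurable A -> borel_measurable f ->
  borel_measurable (fun y => A y (f y)).
Proof.
move=> mA /borel_measurable_coord mf; apply/borel_measurable_coord => j.
rewrite (_ : (fun y => _) = (fun y =>
    \sum_i v2r (f y) 0 i * v2r (A y (basis_vector i)) 0 j)); last first.
  apply/funext => y; rewrite {1}(v2r_sum (f y)) !linear_sum summxE.
  by apply: eq_bigr => i _; rewrite !linearZ mxE.
apply: measurable_sum => i; apply: measurable_funM => //.
have /borel_measurable_coord : borel_measurable (fun y => A y (basis_vector i)).
  exact: borel_measurable_comp (@bop_eval_continuous _ _ _ _) mA.
exact.
Qed.

End kernel_measurability.

(** * An Arzela-Ascoli theorem for bounded continuous functions *)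

Lemma fmap_ultra (T U : Type) (f : T -> U) (F : set_system T) :
  UltraFilter F -> UltraFilter (f @ F).
Proof.
move=> UF; split=> [|G GP FG]; first exact: fmap_proper_filter.
apply/seteqP; split=> [A GA|A]; last exact: FG.
have [//|FA] := in_ultra_setVsetC (f @^-1` A) UF.
have /(filterI GA) : G (~` A) by exact: FG.
by rewrite setICr => /filter_ex[].
Qed.

Section ascoli.
Context {R : realType} {X : ptopologicalType} {W : normedModType R}.

Lemma BC_bounded (h : BC X W) : bounded_on setT h.
Proof. by have [] := asboolP _ (bcP h). Qed.

Lemma BC_normB_le (g h : BC X W) (e : R) :
  (forall x, `|g x - h x| <= e) -> `|g - h| <= e.
Proof.
by move=> gh; apply: sup_norm_le => [|x _]; [exists point|exact: gh].
Qed.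

Lemma BC_eval_continuous (x : X) : continuous (fun h : BC X W => h x).
Proof.
move=> h; apply/(@cvgrPdist_lt _ _ _ (nbhs h)) => e e0.
apply/nbhs_ballP; exists e => //= g; rewrite -ball_normE/=.
apply: le_lt_trans; exact: (@sup_norm_ub _ _ _ setT (h - g) x (BC_bounded _)).
Qed.

(** No axiom of a pseudometric is imposed on [rho]: it absorbs the constant in
    front of the distance that serves as modulus of continuity. *)
Definition dominated_modulus (M : R) (rho : X -> X -> R) :=
  [set h : BC X W | (forall x, `|h x| <= M) /\
    forall x z, `|h x - h z| <= rho x z].

Lemma dominated_modulus_closed M rho : closed (dominated_modulus M rho).
Proof.
have -> : dominated_modulus M rho =
    (\bigcap_x [set h : BC X W | `|h x| <= M]) `&`
    (\bigcap_(t : X * X) [set h : BC X W | `|h t.1 - h t.2| <= rho t.1 t.2]).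
  apply/seteqP; split=> h.
    by move=> [hM hr]; split=> [x|t] _; [exact: hM|exact: hr].
  by move=> [hM hr]; split=> [x|x z]; [exact: hM|exact: (hr (x, z))].
apply: closedI; apply: closed_bigI => t _.
  apply: (@closed_comp _ _ (fun h : BC X W => `|h t|) [set r | r <= M]).
    move=> h _; apply: (@continuous_comp _ _ _ (fun h : BC X W => h t)).
      exact: BC_eval_continuous.
    exact: norm_continuous.
  exact: closed_le.
apply: (@closed_comp _ _ (fun h : BC X W => `|h t.1 - h t.2|)
  [set r | r <= rho t.1 t.2]).
  move=> h _.
  apply: (@continuous_comp _ _ _ (fun h : BC X W => h t.1 - h t.2)).
    by apply: (@cvgB _ _ _ (nbhs h)); exact: BC_eval_continuous.
  exact: norm_continuous.
exact: closed_le.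
Qed.

(** Along an ultrafilter the functions converge pointwise, since their values
    lie in a compact ball; the limit inherits the bound and the modulus. As all
    functions move by less than [e / 3] between a point and some point of a
    finite net for [rho], convergence on that net makes convergence uniform. *)
Lemma ascoli (M : R) (rho : X -> X -> R) :
  compact [set w : W | `|w| <= M] ->
  (forall x e, 0 < e -> \forall z \near x, rho x z < e) ->
  (forall e, 0 < e ->
    exists s : seq X, forall x, exists2 z, z \in s & rho x z < e) ->
  compact (dominated_modulus M rho).
Proof.
move=> cM rho0 totb; rewrite compact_ultra => F UF FS.
have /(_ _)/cid-/all_sig[g gP] x :
    exists w, [set w : W | `|w| <= M] w /\ (fun h : BC X W => h x) @ F --> w.
  move: cM; rewrite compact_ultra.
  move=> /(_ ((fun h : BC X W => h x) @ F) (fmap_ultra _ UF)).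
  apply; change (F [set h | `|h x| <= M]).
  by apply: filterS FS => h [hM _]; exact: hM.
have gM x : `|g x| <= M by case: (gP x).
have grho x z : `|g x - g z| <= rho x z.
  apply: (@closed_cvg _ _ F _ (fun h : BC X W => `|h x - h z|)
    [set r | r <= rho x z]); first exact: closed_le.
    by apply: filterS FS => h [_ hr]; exact: hr.
  apply: cvg_norm; exact: (@cvgB _ _ _ F _ (fun h : BC X W => h x)
    (fun h : BC X W => h z) _ _ (gP x).2 (gP z).2).
have gBC : g \in @bounded_continuous R X W.
  apply/asboolP; split; last by exists M.
  move=> x; apply/(@cvgrPdist_lt _ _ _ (nbhs x)) => e e0.
  by apply: filterS (rho0 x e e0) => z; exact: le_lt_trans.
exists (BCfun gBC); split => //=; apply/(@cvgrPdist_le _ _ _ F) => e e0.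
have e3 : 0 < e / 3 by rewrite divr_gt0.
have [s snet] := totb _ e3.
have : F [set h : BC X W | forall z, z \in s -> `|g z - h z| <= e / 3].
  elim: s {snet} => [|z s ih]; first by apply: filterS filterT => h _ z.
  have := (gP z).2; move=> /(@cvgrPdist_le _ _ _ _ _) /(_ _ e3) gz.
  apply: filterS2 gz ih => h hz hs w; rewrite inE => /orP[/eqP->//|].
  exact: hs.
apply: filterS2 FS => h [_ hrho] hs; apply: BC_normB_le => x /=.
have [z zs xz] := snet x.
have -> : g x - h x = (g x - g z) + (g z - h z) + (h z - h x).
  by rewrite !addrA !subrK.
have -> : e = e / 3 + e / 3 + e / 3 by field.
rewrite (le_trans (ler_normD _ _))// lerD//.
  rewrite (le_trans (ler_normD _ _))// lerD// ?hs//.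
  exact: le_trans (grho _ _) (ltW xz).
by rewrite distrC (le_trans (hrho _ _))// ltW.
Qed.

End ascoli.

(** * The mean distance between kernels *)

Section kernel_distance.
Context {R : realType} {d : measure_display} {Y : measurableType d}.
Context {mu : {measure set Y -> \bar R}} {V W : finBanachType R}.
Implicit Types A B C : Y -> bop V W.

(** The distance in L^1 of two kernels, for the norm [basis_norm]. It is
    extended-real valued, so that it makes sense before integrability is
    known. *)
Definition kernel_dist A B : \bar R :=
  (\int[mu]_y (basis_norm (A y - B y))%:E)%E.

Lemma kernel_dist_ge0 A B : (0 <= kernel_dist A B)%E.
Proof. by apply: integral_ge0 => y _; rewrite lee_fin basis_norm_ge0. Qed.

Lemma kernel_distC A B : kernel_dist A B = kernel_dist B A.
Proof. by apply: eq_integral => y _; rewrite basis_normC. Qed.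

Lemma kernel_distD A B C :
  borel_measurable A -> borel_measurable B -> borel_measurable C ->
  (kernel_dist A C <= kernel_dist A B + kernel_dist B C)%E.
Proof.
move=> mA mB mC; rewrite /kernel_dist -ge0_integralD//=; last 4 first.
- by move=> y _; rewrite lee_fin basis_norm_ge0.
- exact/measurable_EFinP/measurable_basis_normB.
- by move=> y _; rewrite lee_fin basis_norm_ge0.
- exact/measurable_EFinP/measurable_basis_normB.
apply: ge0_le_integral_nonmeasurable => y.
  by rewrite lee_fin basis_norm_ge0.
by rewrite -EFinD lee_fin basis_normB.
Qed.

(** Here [`|A y - B y|] need not be known to be measurable, so the constant
    cannot be moved out of its integral; it is moved out of the measurable left
    side instead. *)
Lemma kernel_dist_le A B (e : R) :
  borel_measurable A -> borel_measurable B ->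
  (\int[mu]_y `|A y - B y|%:E <= e%:E)%E ->
  (kernel_dist A B <= (basis_bound V * e)%:E)%E.
Proof.
move=> mA mB ABe; have b0 := @basis_bound_gt0 R V.
rewrite EFinM -lee_pdivrMl//; apply: le_trans ABe.
rewrite -ge0_integralZl_EFin//; last 3 first.
- by move=> y _; rewrite lee_fin basis_norm_ge0.
- exact/measurable_EFinP/measurable_basis_normB.
- by rewrite invr_ge0 ltW.
apply: ge0_le_integral_nonmeasurable => y.
  by rewrite lee_fin mulr_ge0 ?basis_norm_ge0// invr_ge0 ltW.
by rewrite -EFinM lee_fin ler_pdivrMl// basis_norm_le.
Qed.

Lemma kernel_dist_integrable A B : L1_fun mu A -> L1_fun mu B ->
  mu.-integrable [set: Y] (EFin \o (fun y => basis_norm (A y - B y))).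
Proof.
move=> LA LB; have [mA _] := LA; have [mB _] := LB.
apply: (@le_integrable _ _ _ _ _ measurableT _ (fun y =>
    (basis_bound V)%:E * (`|A y|%:E + `|B y|%:E))%E).
- exact/measurable_EFinP/measurable_basis_normB.
- move=> y _ /=; rewrite lee_fin ger0_norm ?basis_norm_ge0//.
  rewrite ger0_norm; last by rewrite mulr_ge0 ?(ltW basis_bound_gt0)// addr_ge0.
  rewrite (le_trans (basis_norm_le _))// ler_pM2l ?basis_bound_gt0//.
  exact: ler_normB.
exact: (integrableZl measurableT (basis_bound V)
  (integrableD measurableT (L1_fun_norm LA) (L1_fun_norm LB))).
Qed.

Lemma kernel_dist_fin_num A B : L1_fun mu A -> L1_fun mu B ->
  kernel_dist A B \is a fin_num.
Proof.
by move=> LA LB; exact: integrable_fin_num (kernel_dist_integrable LA LB).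
Qed.

Lemma L1_kernel_apply A (f : Y -> V) (M : R) : 0 <= M ->
  L1_fun mu A -> borel_measurable f -> {ae mu, forall y, `|f y| <= M} ->
  L1_fun mu (fun y => A y (f y)) /\
  (\int[mu]_y `|A y (f y)|%:E <= M%:E * \int[mu]_y `|A y|%:E)%E.
Proof.
move=> M0 [mA Aoo] mf fM; have mAf := borel_measurable_bop mA mf.
have Af : (\int[mu]_y `|A y (f y)|%:E <= M%:E * \int[mu]_y `|A y|%:E)%E.
  rewrite -ge0_integralZl_EFin//; last first.
    by apply/measurable_EFinP; exact: measurable_norm.
  apply: ae_ge0_le_integral => //.
  - by apply/measurable_EFinP; exact: measurable_norm.
  - by move=> y _; rewrite mule_ge0.
  - by apply/measurable_EFinP/measurable_funM => //; exact: measurable_norm.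
  apply: filterS fM => y fyM _; rewrite -EFinM lee_fin.
  by rewrite (le_trans (norm_bop _ _))// mulrC ler_wpM2r.
split => //; split => //; apply: le_lt_trans Af _.
by rewrite lte_mul_pinfty// lee_fin.
Qed.

(** Operators close in mean have close integrals against bounded functions,
    uniformly over functions with the same bound. *)
Lemma kernel_integral_dist A B (f : Y -> V) (M : R) : 0 <= M ->
  L1_fun mu A -> L1_fun mu B ->
  borel_measurable f -> {ae mu, forall y, `|f y| <= M} ->
  `|vector_integral mu (fun y => A y (f y)) -
    vector_integral mu (fun y => B y (f y))| <=
  vector_integral_bound W * (coord_bound V * M) * fine (kernel_dist A B).
Proof.
move=> M0 LA LB mf fM.
have [LAf _] := L1_kernel_apply M0 LA mf fM.
have [LBf _] := L1_kernel_apply M0 LB mf fM.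
rewrite -vector_integralB//; set h := _ - _.
have Lh : L1_fun mu h by exact: L1_funB.
rewrite (le_trans (norm_vector_integral Lh))// -mulrA.
rewrite ler_wpM2l ?vector_integral_bound_ge0//.
have cM0 : 0 <= coord_bound V * M by rewrite mulr_ge0// ltW// coord_bound_gt0.
have [mA _] := LA; have [mB _] := LB; have [mh _] := Lh.
rewrite /Rintegral -lee_fin EFinM !fineK ?kernel_dist_fin_num//; last first.
  exact: integrable_fin_num (L1_fun_norm Lh).
rewrite -ge0_integralZl_EFin//; last 2 first.
- by move=> y _; rewrite lee_fin basis_norm_ge0.
- exact/measurable_EFinP/measurable_basis_normB.
apply: ae_ge0_le_integral => //.
- by apply/measurable_EFinP; exact: measurable_norm.
- by move=> y _; rewrite -EFinM lee_fin mulr_ge0// basis_norm_ge0.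
- exact/measurable_EFinP/measurable_funM/measurable_basis_normB.
apply: filterS fM => y fyM _; rewrite -EFinM lee_fin.
apply: (le_trans (norm_bop_basis (A y - B y) (f y))).
by rewrite ler_wpM2r ?basis_norm_ge0// ler_wpM2l// ltW// coord_bound_gt0.
Qed.

End kernel_distance.
Arguments kernel_dist {R d Y} mu {V W} A B.

Section kernel_continuity.
Context {R : realType} {d : measure_display} {Y : measurableType d}.
Context {mu : {measure set Y -> \bar R}} {V W : finBanachType R}.

(** Continuity of the kernel as a map into L^1. Dominated convergence applies to
    sequences, so a sequence [z n] tending to [x] with [K (z n)] away from [K x]
    is extracted from the failure of continuity. It is taken inside [U], where
    [D] dominates; countably many exceptional null sets are then discarded. *)
Lemma kernel_dist_near (X : normedModType R) (K : X -> Y -> bop V W) (x : X) :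
  (forall z, borel_measurable (K z)) ->
  {ae mu, forall y, continuous (fun z => K z y)} ->
  (exists (U : set X) (D : Y -> R),
    [/\ open_nbhs x U, mu.-integrable [set: Y] (EFin \o D) &
        forall z, U z -> {ae mu, forall y, `|K z y| <= D y}]) ->
  forall e, 0 < e -> \forall z \near x, (kernel_dist mu (K x) (K z) < e%:E)%E.
Proof.
move=> mK cK [U [D [[oU Ux] intD KD]]] e e0; apply: contrapT => far.
have /(_ _)/cid-/all_sig[z zP] (n : nat) : exists z, [/\ U z,
    `|x - z| < n.+1%:R^-1 & (e%:E <= kernel_dist mu (K x) (K z))%E].
  apply: contrapT => /forallNP nz; apply: far.
  have nU : nbhs x U by exact: open_nbhs_nbhs.
  have nB : nbhs x (ball x (n.+1%:R^-1 : R)).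
    by apply: nbhsx_ballx; rewrite invr_gt0.
  apply: filterS2 nU nB => z Uz; rewrite -ball_normE/= => xz.
  by rewrite ltNge; apply/negP => ez; apply: (nz z); split.
have zx : z n @[n --> \oo] --> x.
  apply/cvgrPdist_lt => r r0.
  have := near_infty_natSinv_lt (PosNum r0); apply: filterS => n /= nr.
  by apply: lt_trans nr; have [] := zP n.
pose f_ n y := (basis_norm (K x y - K (z n) y))%:E.
have b0 : 0 < basis_bound V by exact: basis_bound_gt0.
have cvg0 : {ae mu, forall y, [set: Y] y -> f_ n y @[n --> \oo] --> 0%E}.
  apply: filterS cK => y cKy _; apply: cvg_EFin; first exact: nearW.
  apply: (@squeeze_cvgr _ _ _ _ (cst 0)
    (fun n => basis_bound V * `|K x y - K (z n) y|)).
  - by apply: nearW => n; rewrite basis_norm_ge0 basis_norm_le.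
  - exact: cvg_cst.
  - rewrite -(mulr0 (basis_bound V)); apply: cvgMr.
    have Kzx : K (z n) y @[n --> \oo] --> K x y.
      exact: (cvg_comp _ (fun z => K z y) zx (cKy x)).
    rewrite -[X in _ --> X](@normr0 _ (bop V W)) -(subrr (K x y)).
    by apply: cvg_norm; apply: cvgB => //; exact: cvg_cst.
have dom : {ae mu, forall y n, [set: Y] y ->
    (`|f_ n y| <= (basis_bound V)%:E * ((D y)%:E + (D y)%:E))%E}.
  have Uz n : U (z n) by have [] := zP n.
  have := KD x Ux; have := ae_foralln (fun n => KD (z n) (Uz n)).
  apply: filterS2 => y Kz Kx n _.
  rewrite /f_ gee0_abs ?lee_fin ?basis_norm_ge0//.
  rewrite (le_trans (basis_norm_le _))// ler_pM2l//.
  by rewrite (le_trans (ler_normB _ _))// lerD.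
have [] := @dominated_convergence _ _ _ mu _ measurableT f_ (cst 0%E)
  (fun y => (basis_bound V)%:E * ((D y)%:E + (D y)%:E))%E _ _ cvg0 _ dom.
- by move=> n; exact/measurable_EFinP/measurable_basis_normB.
- exact: measurable_cst.
- exact: (integrableZl measurableT _ (integrableD measurableT intD intD)).
move=> _ _; rewrite integral0.
move=> /fine_cvgP[ffin /cvgrPdist_lt/(_ e e0)] fe.
near \oo => n.
have [_ _] := zP n; apply/negP; rewrite -ltNge.
rewrite -[kernel_dist _ _ _]fineK; last by near: n.
rewrite lte_fin; apply: le_lt_trans (ler_norm _) _.
by rewrite -normrN -sub0r; near: n.
Unshelve. all: by end_near. Qed.

(** The images of the points outside a large ball are close to the images of
    their radial projections on that ball, which is compact. *)
Lemma kernel_totally_bounded (X : finBanachType R) (K : X -> Y -> bop V W) :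
  (forall x, borel_measurable (K x)) ->
  (forall x e, 0 < e ->
    \forall z \near x, (kernel_dist mu (K x) (K z) < e%:E)%E) ->
  (forall eps : R, 0 < eps ->
    exists (T : X -> R) (L : X -> Y -> bop V W),
      (forall v : X, `|v| = 1 ->
        [/\ 0 < T v, L1_fun mu (L v) &
            forall t : R, T v <= t ->
              (\int[mu]_y (`|K (t *: v) y - L v y|)%:E <= eps%:E)%E]) /\
      has_ubound [set T v | v in [set v : X | `|v| = 1]]) ->
  forall e : R, 0 < e -> exists s : seq X, forall x, exists2 z, z \in s &
    (kernel_dist mu (K x) (K z) < e%:E)%E.
Proof.
move=> mK cK K1 e e0; have b0 := @basis_bound_gt0 R V.
have be0 : 0 < (basis_bound V)^-1 * (e / 4).
  by rewrite mulr_gt0 ?invr_gt0 ?divr_gt0.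
have [T [L [TL [T0 T0ub]]]] := K1 _ be0.
(* Beyond [T v], the kernel along the ray of [v] is [e / 4]-close to [L v]. *)
have radial v t : `|v| = 1 -> T v <= t ->
    (kernel_dist mu (K (t *: v)) (L v) <= (e / 4)%:E)%E.
  move=> v1 Tt; have [_ [mL _] /(_ t Tt) KL] := TL v v1.
  apply: le_trans (kernel_dist_le (mK _) mL KL) _.
  by rewrite mulVKf// gt_eqF.
(* An absolute value, because [T0] may be negative if [X] is trivial. *)
have := @closed_ball_compact R X `|T0|; rewrite compact_cover.
move=> /(_ X setT (fun z => interior
  [set w | (kernel_dist mu (K z) (K w) < (e / 2)%:E)%E])).

case.
- by move=> z _; exact: open_interior.
- by move=> z _; exists z => //; apply: cK; rewrite divr_gt0.
move=> D _ Dcover; exists (finmap.enum_fset D).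
have net w : `|w| <= `|T0| -> exists2 z, z \in finmap.enum_fset D &
    (kernel_dist mu (K w) (K z) < (e / 2)%:E)%E.
  move=> wT; have [z Dz zw] := Dcover w wT; exists z => //.
  by rewrite kernel_distC; exact: interior_subset zw.
move=> x; have [xT|Tx] := leP `|x| `|T0|.
  have [z Dz xz] := net x xT; exists z => //; apply: lt_trans xz _.
  by rewrite lte_fin ltr_pdivrMr// ltr_pMr// ltr1n.
have x0 : 0 < `|x| by exact: le_lt_trans Tx.
pose v := `|x|^-1 *: x.
have v1 : `|v| = 1 by rewrite normrZ normfV normr_id mulVf// gt_eqF.
have Tv : T v <= `|T0|.
  by rewrite (le_trans _ (ler_norm _))//; apply: T0ub; exists v.
have [|z Dz wz] := net (`|T0| *: v); first by rewrite normrZ v1 mulr1 normr_id.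
exists z => //.
have xv : x = `|x| *: v by rewrite scalerA mulfV ?scale1r// gt_eqF.
have [_ [mL _] _] := TL v v1.
have := radial v `|x| v1 (le_trans Tv (ltW Tx)); rewrite -xv => xL.
have Lw := radial v `|T0| v1 Tv; rewrite kernel_distC in Lw.
apply: le_lt_trans (kernel_distD (mK _) mL (mK _)) _.
have -> : e = e / 4 + (e / 4 + e / 2) by field.
have fin A B (r : R) : (kernel_dist mu A B <= r%:E)%E ->
    kernel_dist mu A B \is a fin_num.
  move=> ABr; rewrite ge0_fin_numE ?kernel_dist_ge0//.
  exact: le_lt_trans ABr (ltry _).
rewrite EFinD lee_ltD//; first exact: fin xL.
apply: le_lt_trans (kernel_distD mL (mK (`|T0| *: v)) (mK _)) _.
by rewrite EFinD lee_ltD//; exact: fin Lw.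
Qed.

End kernel_continuity.

(** * The Fredholm operator *)

Section fredholm_operator.
Context {R : realType} {d : measure_display} {Y : measurableType d}.
Context {mu : {measure set Y -> \bar R}} {X E : finBanachType R}.
Context (K : X -> Y -> bop E E) (c : R).
Context (L1K : forall x, L1_fun mu (K x)).
Context (normK : forall x, (\int[mu]_y `|K x y|%:E <= c%:E)%E).
Context (nearK : forall x e, 0 < e ->
  \forall z \near x, (kernel_dist mu (K x) (K z) < e%:E)%E).

(** The representative of [q] chosen here does not matter, by
    [fredholm_funE]. *)
Definition fredholm_fun (q : Linfty mu E) (x : X) : E :=
  vector_integral mu (fun y => K x y (Linfty_repr q y)).

Definition modulus_bound : R := vector_integral_bound E * coord_bound E.

Lemma modulus_bound_ge0 : 0 <= modulus_bound.
Proof.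
by rewrite mulr_ge0 ?vector_integral_bound_ge0// ltW// coord_bound_gt0.
Qed.

Lemma Linfty_measurable (f : Linfty_fun mu E) : borel_measurable f.
Proof. by have [] := asboolP _ (Linfty_funP f). Qed.

Lemma L1_kernel_Linfty (f : Linfty_fun mu E) x :
  L1_fun mu (fun y => K x y (f y)).
Proof.
have [mf /ae_boundedP[M fM]] := asboolP _ (Linfty_funP f).
apply: (L1_kernel_apply (normr_ge0 M) (L1K x) mf _).1.
by apply: filterS fM => y; move=> /le_trans; apply; exact: ler_norm.
Qed.

Lemma fredholm_funE f x : fredholm_fun (Linfty_class f) x =
  vector_integral mu (fun y => K x y (f y)).
Proof.
apply: ae_eq_vector_integral; [exact: L1_kernel_Linfty..|].
have /Linfty_classP :
    Linfty_class (Linfty_repr (Linfty_class f)) = Linfty_class f.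
  exact: reprK.
by apply: filterS => y ->.
Qed.

Lemma fredholm_fun_le q x :
  `|fredholm_fun q x| <= vector_integral_bound E * c * `|q|.
Proof.
have mq := Linfty_measurable (Linfty_repr q).
have [Lq qle] :=
  L1_kernel_apply (normr_ge0 q) (L1K x) mq (ae_le_Linfty_norm q).
rewrite (le_trans (norm_vector_integral Lq))// -mulrA.
rewrite ler_wpM2l ?vector_integral_bound_ge0// mulrC.
rewrite -lee_fin fineK; last exact: integrable_fin_num (L1_fun_norm Lq).
by rewrite (le_trans qle)// EFinM lee_pmul// integral_ge0.
Qed.

Lemma fredholm_fun_dist q x z :
  `|fredholm_fun q x - fredholm_fun q z| <=
  modulus_bound * `|q| * fine (kernel_dist mu (K x) (K z)).
Proof.
rewrite -[modulus_bound * _]mulrA.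
apply: kernel_integral_dist => //; first exact: Linfty_measurable.
exact: ae_le_Linfty_norm.
Qed.

(** The denominator [b + 1] avoids a case distinction on [b = 0]. *)
Lemma scaled_kernel_dist_lt (b e : R) x z : 0 <= b ->
  (kernel_dist mu (K x) (K z) < (e / (b + 1))%:E)%E ->
  b * fine (kernel_dist mu (K x) (K z)) < e.
Proof.
move=> b0 Kxz.
have : fine (kernel_dist mu (K x) (K z)) < e / (b + 1).
  by rewrite -lte_fin fineK// kernel_dist_fin_num.
rewrite ltr_pdivlMr ?ltr_wpDl//; apply: le_lt_trans.
by rewrite mulrC ler_wpM2l ?lerDl// fine_ge0// kernel_dist_ge0.
Qed.

Lemma scaled_kernel_dist_near (b : R) x e : 0 <= b -> 0 < e ->
  \forall z \near x, b * fine (kernel_dist mu (K x) (K z)) < e.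
Proof.
move=> b0 e0; have be : 0 < e / (b + 1) by rewrite divr_gt0// ltr_wpDl.
by apply: filterS (nearK x be) => z; exact: scaled_kernel_dist_lt.
Qed.

Lemma fredholm_fun_BC q : fredholm_fun q \in @bounded_continuous R X E.
Proof.
apply/asboolP; split; last first.
  exists (vector_integral_bound E * c * `|q|) => x _; exact: fredholm_fun_le.
move=> x; apply/(@cvgrPdist_lt _ _ _ (nbhs x)) => e e0.
have b0 : 0 <= modulus_bound * `|q| by rewrite mulr_ge0// modulus_bound_ge0.
apply: filterS (scaled_kernel_dist_near x b0 e0) => z.
exact/le_lt_trans/fredholm_fun_dist.
Qed.

Definition fredholm (q : Linfty mu E) : BC X E := BCfun (fredholm_fun_BC q).

Lemma fredholm_linear : linear fredholm.
Proof.
move=> a p q; apply/val_inj/funext => x /=.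
have -> : a *: p + q = Linfty_class (a *: Linfty_repr p + Linfty_repr q).
  by rewrite linearP; congr (_ *: _ + _); exact/esym/reprK.
rewrite fredholm_funE; symmetry.
transitivity (a *: fredholm_fun p x + fredholm_fun q x) => //.
rewrite -vector_integral_lin; [|exact: L1_kernel_Linfty..].
congr vector_integral; apply/funext => y.
by rewrite [RHS]linearP.
Qed.

HB.instance Definition _ :=
  GRing.isLinear.Build R (Linfty mu E) (BC X E) *:%R fredholm fredholm_linear.


(** The image of a bounded set lies in a set of functions with a common bound
    and modulus, to which Arzela-Ascoli applies. *)
Lemma fredholm_compact :
  (forall e : R, 0 < e -> exists s : seq X, forall x, exists2 z, z \in s &
    (kernel_dist mu (K x) (K z) < e%:E)%E) ->
  compact_operator fredholm.
Proof.
move=> totb A /ex_strict_bound_gt0[M M0 AM].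
pose b := modulus_bound * M.
have b0 : 0 <= b by rewrite mulr_ge0 ?modulus_bound_ge0 ?ltW.
pose rho x z := b * fine (kernel_dist mu (K x) (K z)).
pose S := @dominated_modulus R X E (vector_integral_bound E * c * M) rho.
have c0 : 0 <= c.
  by rewrite -lee_fin (le_trans _ (normK 0))// integral_ge0.
have cS : compact S.
  apply: ascoli; first exact: closed_ball_compact.
    by move=> x e; exact: scaled_kernel_dist_near.
  move=> e e0; have be : 0 < e / (b + 1) by rewrite divr_gt0// ltr_wpDl.
  have [s snet] := totb _ be; exists s => x; have [z zs xz] := snet x.
  by exists z => //; exact: scaled_kernel_dist_lt.
apply: (subclosed_compact _ cS); first exact: closed_closure.
have : fredholm @` A `<=` S.
  move=> _ [q Aq <-]; have qM : `|q| <= M by exact/ltW/AM.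
  split=> [x|x z] /=.
    by rewrite (le_trans (fredholm_fun_le q x))// ler_wpM2l ?mulr_ge0//
      vector_integral_bound_ge0.
  rewrite (le_trans (fredholm_fun_dist q x z))// ler_wpM2r//.
    by rewrite fine_ge0// kernel_dist_ge0.
  by rewrite ler_wpM2l// modulus_bound_ge0.
move=> /closureS; rewrite -(closure_id S).1//.
exact: dominated_modulus_closed.
Qed.

End fredholm_operator.

Unset Implicit Arguments.
Set Strict Implicit.

Theorem theorem4 (R : realType) (X E : finBanachType R)
  (d : measure_display) (Y : measurableType d)
  (mu : {measure set Y -> \bar R}) (K : X -> Y -> bop E E)
  (Car1 : forall x : X, borel_measurable (K x))
  (Car2 : {ae mu, forall y : Y, continuous (fun x : X => K x y)})
  (Car3 : forall x : X, exists (U : set X) (D : Y -> R),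
    [/\ open_nbhs x U,
        mu.-integrable [set: Y] (EFin \o D) &
        forall z : X, U z -> {ae mu, forall y : Y, `|K z y| <= D y}])
  (Car4 : (ereal_sup [set \int[mu]_y (`|K x y|)%:E | x in [set: X]] < +oo)%E)
  (K1 : forall eps : R, 0 < eps ->
    exists (T : X -> R) (L : X -> Y -> bop E E),
      (forall v : X, `|v| = 1 ->
        [/\ 0 < T v,
            L1_fun mu (L v) &
            forall t : R, T v <= t ->
              (\int[mu]_y (`|K (t *: v) y - L v y|)%:E <= eps%:E)%E]) /\
      has_ubound [set T v | v in [set v : X | `|v| = 1]]) :
  exists F : {linear Linfty mu E -> BC X E},
    (forall (f : Linfty_fun mu E) (x : X),
       L1_fun mu (fun y => K x y (f y)) /\
       F (Linfty_class f) x = bochner_integral mu (fun y => K x y (f y))) /\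
    compact_operator F.
Proof.
set c := ereal_sup _ in Car4.
have normK x : (\int[mu]_y `|K x y|%:E <= (fine c)%:E)%E.
  have Kc : (\int[mu]_y `|K x y|%:E <= c)%E.
    by apply: ereal_sup_ubound; exists x.
  rewrite fineK// ge0_fin_numE//; apply: le_trans Kc; exact: integral_ge0.
have L1K x : L1_fun mu (K x).
  by split; [exact: Car1|exact: le_lt_trans (normK x) (ltry _)].
have nearK x e : 0 < e ->
    \forall z \near x, (kernel_dist mu (K x) (K z) < e%:E)%E.
  by apply: kernel_dist_near => //; exact: Car3.
exists (fredholm L1K normK nearK); split=> [f x|]; last first.
  by apply: fredholm_compact; exact: kernel_totally_bounded.
have Lf := L1_kernel_Linfty L1K f x.
by split => //; rewrite bochner_integralE// [LHS](fredholm_funE L1K).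
Qed.
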